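(* Let $\Lambda\subseteq I[\ell,m]$ and let $E_\Lambda=\{p=(p_\alpha)\in G(\ell,m) : p_\alpha=0\ \text{for all}\ \alpha\in\Lambda\}$ be the corresponding linear section of the Grassmannian $G(\ell,m)\subseteq\mathbb{P}^{k-1}(\overline{\mathbb{F}}_q)$, $k=\binom{m}{\ell}$. Then $E_\Lambda$ satisfies the FFN$(1,q)$-property.
   Context: $\mathbb{F}_q$ is a finite field with $q$ elements, $\overline{\mathbb{F}}_q$ an algebraic closure, $E$ an $\mathbb{F}_q$-vector space of dimension $m$, and $\overline{E}=E\otimes_{\mathbb{F}_q}\overline{\mathbb{F}}_q$. $G(\ell,m)=G(\ell,\overline{E})$ is the Grassmannian of $\ell$-dimensional subspaces of $\overline{E}$, embedded by the Plücker map in $\mathbb{P}(\wedge^\ell\overline{E})=\mathbb{P}^{k-1}(\overline{\mathbb{F}}_q)$, with Plücker coordinates $p_\alpha$ relative to a basis of $E$. The indices $\alpha$ run over $I(\ell,m)=\{(\alpha_1,\ldots,\alpha_\ell)\in\mathbb{Z}^\ell : 1\leq\alpha_1<\cdots<\alpha_\ell\leq m\}$. $I[\ell,m]$ is the set of $\ell$-element subsets (non-ordered $\ell$-tuples) of $[m]=\{1,\ldots,m\}$; $\alpha\in I(\ell,m)$ is identified with its support $\{\alpha_1,\ldots,\alpha_\ell\}\in I[\ell,m]$. A projective subvariety $X\subseteq\mathbb{P}^{k-1}(\overline{\mathbb{F}}_q)$ defined over $\mathbb{F}_q$ satisfies the FFN$(1,q)$-property if every homogeneous linear polynomial with coefficients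 in $\mathbb{F}_q$ that vanishes on its set of $\mathbb{F}_q$-rational points $X(\mathbb{F}_q)$ also vanishes on the whole of $X$. *)

(* Defs.v *)
From HB Require Import structures.
From mathcomp Require Import all_boot all_order all_algebra.

Set Implicit Arguments.
Unset Strict Implicit.
Unset Printing Implicit Defensive.

Import GRing.Theory.
Local Open Scope ring_scope.

(* I(l, m), with entries in {0, ..., m-1} instead of {1, ..., m}. *)
Notation incr_idx l m := {t : l.-tuple 'I_m | sorted ltn (map val t)}.

Definition supp l m (a : incr_idx l m) : {set 'I_m} := [set i in val a].

(* I[l, m] *)
Definition subsets_of_card l m : {set {set 'I_m}} := [set A : {set 'I_m} | #|A| == l].

Lemma card_incr_idx l m : #|{: incr_idx l m}| = 'C(m, l).
Proof.
by rewrite card_sig -card_ltn_sorted_tuples; apply: eq_card => t; rewrite !inE.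
Qed.

Section Projective.

Variables (F : fieldType) (K : fieldType) (iota : {rmorphism F -> K}).
Variable I : finType.

(* The points of P(K^I) are the lines through the origin of K^I. *)
Definition proj_point := {L : {vspace {ffun I -> K^o}} | \dim L == 1%N}.

Definition hcoord_zero (p : proj_point) (i : I) : Prop :=
  forall x, x \in val p -> x i = 0.

Definition rational_point (p : proj_point) : Prop :=
  exists x : {ffun I -> F}, val p = <[[ffun i => iota (x i)] : {ffun I -> K^o}]>%VS.

(* The homogeneous linear polynomial \sum_i c_i X_i vanishes at p. *)
Definition linear_form_vanishes (c : {ffun I -> F}) (p : proj_point) : Prop :=
  forall x, x \in val p -> \sum_i iota (c i) * x i = 0.

(* FFN(1, q), with q = #|F| when F is finite. *)
Definition FFN1 (X : proj_point -> Prop) : Prop :=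
  forall c : {ffun I -> F},
    (forall p, X p -> rational_point p -> linear_form_vanishes c p) ->
    forall p, X p -> linear_form_vanishes c p.

End Projective.

Section Grassmannian.

Variables (F K : fieldType) (iota : {rmorphism F -> K}).
Variables (E : vectType F) (Ebar : vectType K).

(* j : E -> Ebar exhibits Ebar as the tensor product of E with K over F
   (universal property of the extension of scalars along iota).  As Ebar is
   finite dimensional, finite dimensional targets V suffice. *)
Definition is_scalar_extension (j : {linear E -> Ebar | iota \; *:%R}) : Prop :=
  forall (V : vectType K) (f : {linear E -> V | iota \; *:%R}),
    exists! g : 'Hom(Ebar, V), forall v, g (j v) = f v.

Variables (j : {linear E -> Ebar | iota \; *:%R}).
Variables (l m : nat) (e : m.-tuple E).

(* The maximal minors of the matrix of the coordinates of w_1, ..., w_l in the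
   basis of Ebar induced by the basis e of E: these are the coordinates of
   w_1 /\ ... /\ w_l in the basis of the l-th exterior power induced by e. *)
Definition plucker_vec (w : l.-tuple Ebar) : {ffun incr_idx l m -> K^o} :=
  [ffun a : incr_idx l m =>
    \det (\matrix_(r < l, s < l)
            coord (map_tuple j e) (tnth (val a) s) (tnth w r))].

(* The image under the Pluecker map of the set of l-dimensional subspaces W of
   Ebar; the line spanned by plucker_vec w does not depend on the basis w of W. *)
Definition grassmannian (p : proj_point K (incr_idx l m)) : Prop :=
  exists (W : {vspace Ebar}) (w : l.-tuple Ebar),
    basis_of W w /\ val p = <[plucker_vec w]>%VS.

Definition linear_section (Lambda : {set {set 'I_m}})
    (p : proj_point K (incr_idx l m)) : Prop :=
  grassmannian p /\ forall a, supp a \in Lambda -> hcoord_zero p a.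

End Grassmannian.

Arguments grassmannian {F K iota E Ebar} j l {m} e p.
Arguments linear_section {F K iota E Ebar} j l {m} e Lambda p.

(* Main.v *)
(* If alpha is not in Lambda, the coordinate subspace spanned by the e_i with i
   in alpha is a rational point of the linear section whose only nonzero Pluecker
   coordinate is p_alpha.  A linear form vanishing at all rational points thus
   only involves the p_alpha with alpha in Lambda, and these vanish on the
   section. *)

Require Import Defs.
From HB Require Import structures.
From mathcomp Require Import all_boot all_order all_algebra.

Set Implicit Arguments.
Unset Strict Implicit.
Unset Printing Implicit Defensive.

Import GRing.Theory.
Local Open Scope ring_scope.

Section IncreasingIndices.

Variables l m : nat.
Implicit Types a b : incr_idx l m.

Lemma incr_idx_uniq a : uniq (val a).
Proof.
rewrite -(map_inj_uniq val_inj).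
exact: (sorted_uniq ltn_trans ltnn (valP a)).
Qed.

Lemma tnth_incr_idx_inj a : injective (tnth (val a)).
Proof. exact/tuple_uniqP/incr_idx_uniq. Qed.

(** A strictly increasing sequence is recovered from its set of entries by sorting. *)
Lemma supp_inj : injective (@supp l m).
Proof.
move=> a b /setP eq_ab; apply/val_inj/val_inj/(inj_map val_inj).
apply: (irr_sorted_eq ltn_trans ltnn (valP a) (valP b)).
by apply: eq_mem_map => i; have:= eq_ab i; rewrite !inE.
Qed.

Lemma card_supp a : #|supp a| = l.
Proof. by rewrite cardsE (card_uniqP (incr_idx_uniq a)) size_tuple. Qed.

(** Both supports have [l] elements, so an inclusion between them would be an equality, and
    [supp_inj] would give [a = b]. *)
Lemma incr_idx_neq_notin a b : a != b -> exists s, tnth (val b) s \notin val a.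
Proof.
move=> neq_ab; apply/existsP; apply: contraR neq_ab => /existsPn ba.
apply/eqP/supp_inj/esym/eqP; rewrite eqEcard !card_supp leqnn andbT.
apply/subsetP => i; rewrite !inE => /tnthP[s ->].
by have:= ba s; rewrite negbK.
Qed.

End IncreasingIndices.

Section CoordinateSubspaces.

Variables (F K : fieldType) (iota : {rmorphism F -> K}).
Variables (E : vectType F) (Ebar : vectType K).
Variables (j : {linear E -> Ebar | iota \; *:%R}) (j_ext : is_scalar_extension j).
Variables (m : nat) (e : m.-tuple E) (e_basis : basis_of {:E} e).

(** A semilinear form on [E], to which the universal property of [Ebar] can be applied. *)
Definition ext_coord (i : 'I_m) (v : E) : K^o := iota (coord e i v).

Lemma ext_coord_is_linear i : linear_for (iota \; *:%R) (ext_coord i).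
Proof. by move=> k u v; rewrite /ext_coord linearP rmorphD rmorphM. Qed.

HB.instance Definition _ i :=
  GRing.isLinear.Build F E K^o (iota \; *:%R) (ext_coord i)
    (ext_coord_is_linear i).

(** The universal property extends each [ext_coord i] to a [K]-linear form [g] on [Ebar]; applied to
    a vanishing combination of the [j e_i], it isolates the [i]-th coefficient. *)
Lemma scalar_extension_free : free (map_tuple j e).
Proof.
apply/freeP => k sum0 i.
have [g [gj _]] := j_ext (ext_coord i).
have := congr1 g sum0; rewrite linear0 linear_sum (bigD1 i) //= big1; last first.
  move=> i' neq_i'i; rewrite linearZ /= (nth_map 0) ?size_tuple // gj /=.
  rewrite /ext_coord coord_free ?(basis_free e_basis) //.
  by rewrite (negPf neq_i'i) rmorph0 scaler0.
rewrite addr0 linearZ /= (nth_map 0) ?size_tuple // gj /= /ext_coord.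
rewrite coord_free ?(basis_free e_basis) // eqxx rmorph1 => <-.
by rewrite [RHS]mulr1.
Qed.

Variables (l : nat) (a : incr_idx l m).

Definition coord_subspace_basis : l.-tuple Ebar :=
  [tuple tnth (map_tuple j e) (tnth (val a) r) | r < l].

Lemma coord_coord_subspace_basis i r :
  coord (map_tuple j e) i (tnth coord_subspace_basis r)
  = (i == tnth (val a) r)%:R.
Proof.
by rewrite tnth_mktuple (tnth_nth 0) coord_free ?scalar_extension_free // eq_sym.
Qed.

Lemma coord_subspace_basis_free : free coord_subspace_basis.
Proof.
apply/freeP => k sum0 r.
have := congr1 (coord (map_tuple j e) (tnth (val a) r)) sum0.
rewrite linear0 linear_sum (bigD1 r) // big1; last first.
  move=> r' neq_r'r; rewrite linearZ -tnth_nth /= coord_coord_subspace_basis /=.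
  by rewrite (inj_eq (@tnth_incr_idx_inj _ _ a)) eq_sym (negPf neq_r'r) mulr0.
by rewrite [LHS]addr0 linearZ -tnth_nth /= coord_coord_subspace_basis /= eqxx mulr1.
Qed.

(** The minor at [b] has the 0/1 entries [b_s == a_r]. The right-hand side is written as the image
    under [iota] of a vector over [F], so that rationality can be read off. *)
Lemma plucker_vec_coord_subspace :
  plucker_vec j e coord_subspace_basis
  = [ffun b => iota ([ffun b => (b == a)%:R] b)].
Proof.
apply/ffunP => b; rewrite !ffunE rmorph_nat.
have [-> | neq_ba] := eqVneq b a.
  (* For [b = a] the matrix is the identity, because the entries of [a] are distinct. *)
  rewrite -[RHS](det1 K l); congr (\det _); apply/matrixP => r s.
  rewrite !mxE coord_coord_subspace_basis (inj_eq (@tnth_incr_idx_inj _ _ a)).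
  by rewrite eq_sym.
(* Otherwise some [b_s] is not an entry of [a], and column [s] of the matrix is zero. *)
have [|s bs_notin_a] := @incr_idx_neq_notin _ _ a b; first by rewrite eq_sym.
rewrite (expand_det_col _ s) big1 // => r _.
rewrite mxE coord_coord_subspace_basis.
by case: eqP bs_notin_a => [-> | _ _]; rewrite ?mem_tnth ?mul0r.
Qed.

Lemma dim_coord_subspace_line :
  \dim <[plucker_vec j e coord_subspace_basis]>%VS == 1%N.
Proof.
rewrite dim_vline eqb1 plucker_vec_coord_subspace.
(* The spanning vector is nonzero because its coordinate at [a] is 1. *)
apply/eqP => /(congr1 (fun x : {ffun _ -> K^o} => x a)) /eqP.
by rewrite !ffunE eqxx rmorph1 oner_eq0.
Qed.

Definition coord_subspace_point : proj_point K (incr_idx l m) :=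
  exist (fun L : {vspace _} => \dim L == 1%N) _ dim_coord_subspace_line.

Lemma coord_subspace_point_rational : rational_point iota coord_subspace_point.
Proof.
by exists [ffun b => (b == a)%:R]; rewrite /= plucker_vec_coord_subspace.
Qed.

Lemma coord_subspace_point_section (Lambda : {set {set 'I_m}}) :
  supp a \notin Lambda -> linear_section j l e Lambda coord_subspace_point.
Proof.
move=> a_notin; split.
  exists <<coord_subspace_basis>>%VS, coord_subspace_basis; split => //.
  by rewrite /basis_of eqxx coord_subspace_basis_free.
move=> b b_in x /= /vlineP[k ->]; rewrite plucker_vec_coord_subspace !ffunE.
(* The case [b = a] is excluded, since [supp b] lies in [Lambda] and [supp a] does not. *)
by case: eqP b_in a_notin => [-> ->| _ _ _] //; rewrite rmorph0 scaler0.
Qed.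

(** On the generator of the line the form takes the value [iota (c a)], and [iota] is injective as a
    morphism of fields. *)
Lemma linear_form_vanishes_coord_subspace (c : {ffun incr_idx l m -> F}) :
  linear_form_vanishes iota c coord_subspace_point -> c a = 0.
Proof.
move=> /(_ _ (memv_line _)); rewrite plucker_vec_coord_subspace (bigD1 a) //=.
rewrite big1 => [|b neq_ba]; last first.
  by rewrite !ffunE (negPf neq_ba) rmorph0 mulr0.
rewrite !ffunE eqxx rmorph1 mulr1 addr0 => /eqP.
by rewrite fmorph_eq0 => /eqP.
Qed.

End CoordinateSubspaces.

Theorem proposition2p10
  (F : finFieldType) (Fbar : closedFieldType) (iota : {rmorphism F -> Fbar})
  (Fbar_algebraic : forall x : Fbar, algebraicOver iota x)
  (m l : nat) (E : vectType F) (e : m.-tuple E) (e_basis : basis_of {:E} e)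
  (Ebar : vectType Fbar) (j : {linear E -> Ebar | iota \; *:%R})
  (Ebar_ext : is_scalar_extension j)
  (Lambda : {set {set 'I_m}}) (Lambda_sub : Lambda \subset subsets_of_card l m) :
  FFN1 iota (linear_section j l e Lambda).
Proof.
(* The form vanishes at [x] term by term: for each [a], either [x a] or [c a] is zero. *)
move=> c c_rat p [_ p_Lambda] x x_in_p; apply: big1 => a _.
have [a_in | a_notin] := boolP (supp a \in Lambda).
  by rewrite (p_Lambda a a_in x x_in_p) mulr0.
suff -> : c a = 0 by rewrite rmorph0 mul0r.
have point_rat := coord_subspace_point_rational Ebar_ext e_basis a.
have point_in := coord_subspace_point_section Ebar_ext e_basis a_notin.
exact: linear_form_vanishes_coord_subspace (c_rat _ point_in point_rat).
Qed.
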